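(* Let $f$ be a monic univariate polynomial of degree $n$ with real coefficients, all of whose complex roots have nonnegative real part and which has at least one root with positive real part. Write $f(x)=\sum_{i=0}^n (-1)^i a_{n-i}x^{n-i}$ with $a_n=1$ and let $f=p-q$ where $$p(x)=\sum_{0\le 2i\le n} a_{n-2i}\,x^{n-2i},\qquad q(x)=\sum_{1\le 2i+1\le n} a_{n-(2i+1)}\,x^{n-(2i+1)}.$$ Let $r_1\le r_2\le\dots\le r_m$ be the real roots of $f$ (counted with multiplicity), and set $r_0=0$, $r_{m+1}=+\infty$. Let $k\in\{0,1,\dots,m\}$ and let $x_0\in\mathbb{R}$ with $r_k<x_0<r_{k+1}$. Define, for $t=0,1,2,\dots$, $$x_{t+1}=x_t\,\frac{p(x_t)}{q(x_t)},\qquad x_{-(t+1)}=x_{-t}\,\frac{q(x_{-t})}{p(x_{-t})}.$$ If $p(x_0)>q(x_0)$, then $x_t\to r_{k+1}$ and $x_{-t}\to r_k$ as $t\to+\infty$. If $p(x_0)<q(x_0)$, then $x_t\to r_k$ and $x_{-t}\to r_{k+1}$ as $t\to+\infty$.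
   Context: Under the hypotheses on the roots of $f$, all coefficients $a_i$ are nonnegative, so $p$ and $q$ have nonnegative coefficients, all real roots of $f$ are nonnegative, and $p(x)>0$, $q(x)>0$ for all $x>0$, so the iterations are well defined and stay positive. The number $m$ of real roots may be $0$. Convergence to $r_{m+1}=+\infty$ means divergence to $+\infty$. *)

(* Defs.v *)
From HB Require Import structures.
From mathcomp Require Export all_boot all_order all_algebra.
From mathcomp Require Export complex.
From mathcomp Require Export all_classical all_reals all_analysis.
Export Order.TTheory GRing.Theory Num.Theory.
Export numFieldNormedType.Exports.

Set Implicit Arguments.
Unset Strict Implicit.
Unset Printing Implicit Defensive.

Local Open Scope ring_scope.

Definition alt_poly (R : realType) (n : nat) (a : nat -> R) : {poly R} :=
  \sum_(i < n.+1) ((-1) ^+ i * a (n - i)%N) *: 'X^(n - i).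

Definition plus_part (R : realType) (n : nat) (a : nat -> R) : {poly R} :=
  \sum_(i < n.+1 | (2 * i <= n)%N) a (n - 2 * i)%N *: 'X^(n - 2 * i).

Definition minus_part (R : realType) (n : nat) (a : nat -> R) : {poly R} :=
  \sum_(i < n.+1 | (2 * i + 1 <= n)%N)
     a (n - (2 * i + 1))%N *: 'X^(n - (2 * i + 1)).

Definition complex_root (R : realType) (f : {poly R}) (z : R[i]) : bool :=
  root (map_poly (real_complex R) f) z.

Definition real_roots_seq (R : realType) (f : {poly R}) (r : seq R) : Prop :=
  sorted <=%R r /\ forall x : R, count_mem x r = mup x f.

(* [ext_root r 0] is 0, [ext_root r k] is the [k]-th entry of
   [r] for 1 <= k <= size r, and [+oo], the default of [nth], is the value at
   [(size r).+1]. *)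
Definition ext_root (R : realType) (r : seq R) (k : nat) : \bar R :=
  nth +oo%E (0%:E :: [seq x%:E | x <- r]) k.

(* Since [x] is indexed by [int], the forward and the backward iterations are
   its restrictions to the nonnegative and to the nonpositive integers. *)
Definition two_sided_iteration (R : realType) (p q : {poly R}) (x : int -> R)
    : Prop :=
  forall t : nat,
    x (t.+1)%:Z = x t%:Z * (p.[x t%:Z] / q.[x t%:Z]) /\
    x (- (t.+1)%:Z) = x (- t%:Z) * (q.[x (- t%:Z)] / p.[x (- t%:Z)]).

(* Main.v *)
Require Import Defs.
From mathcomp Require Import zify ring lra.

(** The quotient [p / q] behaves like a holomorphic self-map [W] of the right
half-plane that is real on the real axis: with [F = p + q], which is
[(-1) ^ n f(- x)], the function [(W - 1) / (W + 1) = f / F] is the finite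
Blaschke product of the factors [(x - z) / (x + z^* )] over the roots [z] of
[f], and it is bounded by 1 on the right half-plane because all these roots have
nonnegative real part.  The Schwarz-Pick inequality for [W] at two real points
[0 < x <= y] reads [x / y <= W(y) / W(x) <= y / x]; in other words, both
[x * W(x)] and [x / W(x)] are nondecreasing on the positive half-line.

This inequality has an elementary proof.  If [f = g * h], then the parts of [f]
are [p = p_g p_h + q_g q_h] and [q = p_g q_h + q_g p_h], and the two
monotonicity statements, written without division, survive such a product
([scaled_ratio_leM]).  It is therefore enough to check them on the factors
[x - a] and [x^2 - 2 a x + b] with [a, b >= 0]
([schwarz_pick_real_factor]) and to split off one real factor at a time
([schwarz_pick_of_roots]).  A root with positive real part contributes a factor
that makes [q] positive on the positive half-line ([flipped_gt0]), so the
iterations are well defined.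

The theorem is then about iterating a nondecreasing continuous map [h].
If [h] moves the starting point up, the orbit is nondecreasing; it cannot jump
over a fixed point, and its limit, when finite, is a fixed point.  The fixed
points of both [x * p / q] and [x * q / p] on the positive half-line are the
positive roots of [f = p - q], and there is none strictly between [r_k] and
[r_(k+1)] ([iter_increasing], [iter_decreasing]).  The two maps move [x0] in
opposite directions, and exchanging [p] and [q] exchanges the two cases of the
theorem ([balanced_iterations_cvg]). *)

Set Implicit Arguments.
Unset Strict Implicit.
Unset Printing Implicit Defensive.

Local Open Scope classical_set_scope.
Local Open Scope ring_scope.

(** * The two parts of a polynomial and the Schwarz-Pick inequality *)

(** For a monic [f] these are the values of the monic polynomial whose roots are
the opposites of those of [f].  It is multiplicative in [f], which determines
how the two parts below behave under products. *)
Definition mirror (R : realType) (f : {poly R}) (x : R) : R :=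
  (-1) ^+ (size f).-1 * f.[- x].

(** The monomials of [f] whose degree has the parity of [deg f]; the others, with
their sign changed, form [flipped_part]. *)
Definition kept_part (R : realType) (f : {poly R}) (x : R) : R :=
  (mirror f x + f.[x]) / 2.

Definition flipped_part (R : realType) (f : {poly R}) (x : R) : R :=
  (mirror f x - f.[x]) / 2.

(** The division-free form of: [x * u(x) / v(x)] is nondecreasing for [x > 0].
Being polynomial in the values, it makes sense when [v] vanishes, as the flipped
parts of the factors [x] and [x^2 + b] do. *)
Definition scaled_ratio_le (R : realType) (u v : R -> R) : Prop :=
  forall x y, 0 < x -> x <= y -> x * u x * v y <= y * u y * v x.

(** The difference of the two sides is a combination of the differences in the four
hypotheses, with nonnegative coefficients: each hypothesis is used once. *)
Lemma scaled_ratio_leM (R : realType) (p q c d : R -> R)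
    (p0 : forall x, 0 < x -> 0 <= p x) (q0 : forall x, 0 < x -> 0 <= q x)
    (c0 : forall x, 0 < x -> 0 <= c x) (d0 : forall x, 0 < x -> 0 <= d x) :
  scaled_ratio_le p q -> scaled_ratio_le q p ->
  scaled_ratio_le c d -> scaled_ratio_le d c ->
  scaled_ratio_le (fun x => c x * p x + d x * q x)
                  (fun x => c x * q x + d x * p x).
Proof.
move=> pq qp cd dc x y x_gt0 xy.
have y_gt0 : 0 < y := lt_le_trans x_gt0 xy.
rewrite -subr_ge0.
rewrite (_ : _ - _ =
    c x * c y * (y * p y * q x - x * p x * q y)
  + d x * d y * (y * q y * p x - x * q x * p y)
  + p x * p y * (y * c y * d x - x * c x * d y)
  + q x * q y * (y * d y * c x - x * d x * c y)); last by ring.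
rewrite !addr_ge0 //; apply: mulr_ge0; rewrite ?subr_ge0 ?pq ?qp ?cd ?dc //;
  by rewrite mulr_ge0 // ?p0 ?q0 ?c0 ?d0.
Qed.

(** The Schwarz-Pick inequality for [kept_part f / flipped_part f], with the
signs that make it stable under products. *)
Record schwarz_pick (R : realType) (f : {poly R}) : Prop := SchwarzPick {
  kept_gt0 : forall x, 0 < x -> 0 < kept_part f x;
  flipped_ge0 : forall x, 0 < x -> 0 <= flipped_part f x;
  kept_over_flipped : scaled_ratio_le (kept_part f) (flipped_part f);
  flipped_over_kept : scaled_ratio_le (flipped_part f) (kept_part f) }.

Lemma mirrorM (R : realType) (g h : {poly R}) (x : R) :
  g \is monic -> h \is monic -> mirror (g * h) x = mirror g x * mirror h x.
Proof.
move=> gm hm; rewrite /mirror size_mul ?monic_neq0 // hornerM.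
have: (0 < size g)%N by rewrite size_poly_gt0 monic_neq0.
have: (0 < size h)%N by rewrite size_poly_gt0 monic_neq0.
case: (size g) (size h) => [//|i] [//|j] _ _.
by rewrite addSn addnS /= exprD; ring.
Qed.

Lemma kept_partM (R : realType) (g h : {poly R}) :
  g \is monic -> h \is monic ->
  kept_part (g * h) = fun x =>
    kept_part g x * kept_part h x + flipped_part g x * flipped_part h x.
Proof.
move=> gm hm; apply/funext => x.
by rewrite /kept_part /flipped_part mirrorM // hornerM; field.
Qed.

Lemma flipped_partM (R : realType) (g h : {poly R}) :
  g \is monic -> h \is monic ->
  flipped_part (g * h) = fun x =>
    kept_part g x * flipped_part h x + flipped_part g x * kept_part h x.
Proof.
move=> gm hm; apply/funext => x.
by rewrite /kept_part /flipped_part mirrorM // hornerM; field.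
Qed.

Lemma schwarz_pickM (R : realType) (g h : {poly R}) :
  g \is monic -> h \is monic ->
  schwarz_pick g -> schwarz_pick h -> schwarz_pick (g * h).
Proof.
move=> gm hm [c_gt0 d_ge0 cd dc] [p_gt0 q_ge0 pq qp].
have c_ge0 x : 0 < x -> 0 <= kept_part g x by move=> /c_gt0/ltW.
have p_ge0 x : 0 < x -> 0 <= kept_part h x by move=> /p_gt0/ltW.
split; rewrite ?kept_partM ?flipped_partM //.
- move=> x x0; apply: ltr_wpDr; first exact: mulr_ge0 (d_ge0 x x0) (q_ge0 x x0).
  exact: mulr_gt0 (c_gt0 x x0) (p_gt0 x x0).
- move=> x x0; apply: addr_ge0; first exact: mulr_ge0 (c_ge0 x x0) (q_ge0 x x0).
  exact: mulr_ge0 (d_ge0 x x0) (p_ge0 x x0).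
- exact: scaled_ratio_leM.
- exact: scaled_ratio_leM.
Qed.

(** * Real factors *)

(** The minimal polynomial of [z] over the reals. *)
Definition real_factor (R : realType) (z : R[i]) : {poly R} :=
  if complex.Im z == 0 then 'X - (complex.Re z)%:P
  else ('X - (2 * complex.Re z)%:P) * 'X
       + (complex.Re z ^+ 2 + complex.Im z ^+ 2)%:P.

Lemma size_real_factor (R : realType) (z : R[i]) :
  size (real_factor z) = if complex.Im z == 0 then 2%N else 3%N.
Proof.
rewrite /real_factor; case: ifP => _; first by rewrite size_XsubC.
by rewrite size_MXaddC polyXsubC_eq0 size_XsubC.
Qed.

Lemma monic_real_factor (R : realType) (z : R[i]) : real_factor z \is monic.
Proof.
rewrite monicE lead_coefE size_real_factor /real_factor; case: ifP => _.
  by rewrite coefB coefX coefC subr0.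
by rewrite coefD coefMX coefB coefX !coefC subr0 addr0.
Qed.

Lemma parts_real_factor (R : realType) (z : R[i]) x :
  kept_part (real_factor z) x =
    (if complex.Im z == 0 then x
     else x ^+ 2 + (complex.Re z ^+ 2 + complex.Im z ^+ 2)) /\
  flipped_part (real_factor z) x =
    (if complex.Im z == 0 then complex.Re z else 2 * complex.Re z * x).
Proof.
rewrite /kept_part /flipped_part /mirror size_real_factor /real_factor.
by case: ifP => _ /=; rewrite !(hornerD, hornerN, hornerM, hornerX, hornerC);
  split; field.
Qed.

Lemma schwarz_pick_real_factor (R : realType) (z : R[i]) :
  0 <= complex.Re z -> schwarz_pick (real_factor z).
Proof.
move=> Rz; have E := parts_real_factor z; split.
- move=> x x0; rewrite (E x).1; case: ifP => // _; nra.
- by move=> x x0; rewrite (E x).2; case: ifP => // _; rewrite !mulr_ge0 // ltW.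
- move=> x y x0 xy; rewrite (E x).1 (E y).1 (E x).2 (E y).2; case: ifP => _.
    by rewrite ler_wpM2r // ler_pM // ltW.
  rewrite -subr_ge0 (_ : _ - _ = 2 * complex.Re z * (x * y) * ((y - x) * (y + x)));
    last by ring.
  have y0 := lt_le_trans x0 xy.
  by rewrite !mulr_ge0 ?subr_ge0 ?addr_ge0 // ltW.
- move=> x y x0 xy; rewrite (E x).1 (E y).1 (E x).2 (E y).2; case: ifP => _.
    by rewrite le_eqVlt (_ : _ == _) //; apply/eqP; ring.
  set b := complex.Re z ^+ 2 + _.
  rewrite -subr_ge0 (_ : _ - _ = 2 * complex.Re z * b * ((y - x) * (y + x)));
    last by ring.
  have y0 := lt_le_trans x0 xy.
  by rewrite !mulr_ge0 ?subr_ge0 ?addr_ge0 ?sqr_ge0 // ltW.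
Qed.

Lemma complex_rootM (R : realType) (g h : {poly R}) (z : R[i]) :
  complex_root (g * h) z = complex_root g z || complex_root h z.
Proof. by rewrite /complex_root rmorphM rootM. Qed.

Lemma root_real_factor (R : realType) (z : R[i]) : complex_root (real_factor z) z.
Proof.
rewrite /complex_root /root /real_factor; case: z => u v /=.
have [->|_] := eqVneq v 0.
  rewrite rmorphB /= map_polyX map_polyC hornerD hornerN hornerX hornerC.
  by rewrite subrr.
rewrite rmorphD rmorphM rmorphB /= map_polyX !map_polyC.
rewrite !(hornerD, hornerN, hornerM, hornerX, hornerC) /=.
by rewrite eq_complex; apply/andP; split; apply/eqP => /=; ring.
Qed.

(** When [z] is not real, the remainder of [f] is a real polynomial [c0 + c1 x]
vanishing at [z]; its imaginary part there is [c1 * Im z], so it is zero. *)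
Lemma real_factor_dvd (R : realType) (f : {poly R}) (z : R[i]) :
  complex_root f z -> real_factor z %| f.
Proof.
move=> fz; have [z_real|z_nonreal] := eqVneq (complex.Im z) 0.
  rewrite /real_factor z_real eqxx dvdp_XsubCl -(fmorph_root (real_complex R)).
  by move: fz; rewrite /complex_root {1}(_ : z = (complex.Re z)%:C%C) //;
    case: z z_real => u v /= ->.
apply/modp_eq0P; move rem_def: (f %% real_factor z) => rem.
have rem_size : (size rem <= 2)%N.
  rewrite -ltnS -[X in (_ < X)%N](_ : size (real_factor z) = _).
    by rewrite -rem_def ltn_modp monic_neq0 ?monic_real_factor.
  by rewrite size_real_factor (negPf z_nonreal).
have rem_z : (map_poly (real_complex R) rem).[z] = 0.
  move: fz; rewrite /complex_root {1}(divp_eq f (real_factor z)) rem_def.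
  rewrite rmorphD rmorphM /root hornerD hornerM (eqP (root_real_factor z)) mulr0 add0r.
  by move/eqP.
move: rem_z; rewrite (horner_coef_wide (n := 2)); last by rewrite size_map_poly.
rewrite !big_ord_recl big_ord0 /= !coef_map /=.
case: z z_nonreal {fz rem_def} => u v /= v0 /eqP.
rewrite eq_complex /= => /andP[/eqP re0 /eqP im0].
have c1 : rem`_1 = 0.
  apply/eqP; move/eqP: im0.
  by rewrite !mulr0 !mul0r !addr0 add0r mulf_eq0 (negPf v0) orbF.
have c0 : rem`_0 = 0.
  by move: re0; rewrite [rem`_(bump _ _)]c1 !mul0r mulr1 !subr0 !addr0.
apply/polyP => -[|[|i]]; rewrite coef0 //.
by rewrite nth_default // (leq_trans rem_size).
Qed.

Lemma complex_root_factor (R : realType) (f : {poly R}) (z : R[i]) :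
  f \is monic -> complex_root f z ->
  exists2 g, g \is monic & f = real_factor z * g.
Proof.
move=> fm /real_factor_dvd/dvdpP[g fE].
exists g; last by rewrite mulrC.
by move: fm; rewrite fE monicMr // monic_real_factor.
Qed.

Lemma schwarz_pick1 (R : realType) : schwarz_pick (1 : {poly R}).
Proof.
have c x : kept_part (1 : {poly R}) x = 1.
  by rewrite /kept_part /mirror size_poly1 !hornerE; field.
have d x : flipped_part (1 : {poly R}) x = 0.
  by rewrite /flipped_part /mirror size_poly1 !hornerE; field.
by split => [x|x|x y|x y]; rewrite ?(c, d) // !(mulr0, mul0r).
Qed.

Lemma schwarz_pick_of_roots (R : realType) (f : {poly R}) :
  f \is monic -> (forall z, complex_root f z -> 0 <= complex.Re z) ->
  schwarz_pick f.
Proof.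
have [N] := ubnP (size f); elim: N f => // N IH f; rewrite ltnS => sf fm fr.
have [f1|/closed_rootP[z fz]] := eqVneq (size (map_poly (real_complex R) f)) 1%N.
  move: f1; rewrite size_map_poly => f1.
  suff -> : f = 1 by exact: schwarz_pick1.
  move: fm; rewrite monicE lead_coefE f1 => /eqP f0.
  by rewrite [f]size1_polyC ?f1 // f0.
have [g gm fE] := complex_root_factor fm fz.
rewrite fE; apply: schwarz_pickM; rewrite ?monic_real_factor //.
  exact/schwarz_pick_real_factor/fr.
apply: IH => //.
  apply: leq_trans sf; rewrite fE size_mul ?monic_neq0 ?monic_real_factor //.
  rewrite size_real_factor; case: ifP => _ //=.
by move=> w gw; apply: fr; rewrite fE complex_rootM gw orbT.
Qed.

(** Splitting off the factor of a root [z] with [Re z > 0], the flipped part of [f]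
is bounded below by the product of the flipped part of this factor, which is
positive, with the kept part of the cofactor. *)
Lemma flipped_gt0 (R : realType) (f : {poly R}) :
  f \is monic -> (forall z, complex_root f z -> 0 <= complex.Re z) ->
  (exists2 z, complex_root f z & 0 < complex.Re z) ->
  forall x, 0 < x -> 0 < flipped_part f x.
Proof.
move=> fm fr [z fz z0] x x0.
have [g gm fE] := complex_root_factor fm fz.
have hz := schwarz_pick_real_factor (ltW z0).
have hg : schwarz_pick g.
  apply: schwarz_pick_of_roots => // w gw.
  by apply: fr; rewrite fE complex_rootM gw orbT.
rewrite fE flipped_partM ?monic_real_factor // ltr_wpDl //.
  by rewrite mulr_ge0 ?(ltW (kept_gt0 hz x0)) ?(flipped_ge0 hg x0).
rewrite mulr_gt0 ?(kept_gt0 hg x0) //.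
by rewrite (parts_real_factor z x).2; case: ifP => // _; rewrite !mulr_gt0.
Qed.

(** * Identification of [plus_part] and [minus_part] *)

Lemma sum_even_odd (V : nmodType) (F : nat -> V) (N : nat) :
  \sum_(i < N) F i =
  \sum_(i < N | (2 * i < N)%N) F (2 * i)%N
  + \sum_(i < N | (2 * i + 1 < N)%N) F (2 * i + 1)%N.
Proof.
have even_sum : \sum_(i < N | (2 * i < N)%N) F (2 * i)%N
    = \sum_(i < uphalf N) F (2 * i)%N.
  have leN : (uphalf N <= N)%N by lia.
  rewrite (big_ord_widen N (fun i => F (2 * i)%N) leN).
  by apply: eq_bigl => i; lia.
have odd_sum : \sum_(i < N | (2 * i + 1 < N)%N) F (2 * i + 1)%N
    = \sum_(i < N./2) F (2 * i + 1)%N.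
  have leN : (N./2 <= N)%N by lia.
  rewrite (big_ord_widen N (fun i => F (2 * i + 1)%N) leN).
  by apply: eq_bigl => i; lia.
rewrite {}even_sum {}odd_sum; elim: N => [|N IH]; first by rewrite !big_ord0 addr0.
rewrite big_ord_recr IH /=; have [oddN|evenN] := boolP (odd N).
  have -> : uphalf N = (N./2).+1 by lia.
  rewrite -addrA; congr (_ + _); rewrite big_ord_recr /=; congr (_ + F _); lia.
have -> : uphalf N = N./2 by lia.
by rewrite addrAC big_ord_recr /=; congr (_ + F _ + _); lia.
Qed.

(** The values of [f] and of its mirror image are the difference and the sum of
those of [plus_part] and [minus_part]. *)
Lemma parts_alt_poly (R : realType) (n : nat) (a : nat -> R) (f : {poly R}) x :
  size f = n.+1 -> f = alt_poly n a ->
  (plus_part n a).[x] = kept_part f x /\ (minus_part n a).[x] = flipped_part f x.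
Proof.
move=> sf fE.
pose monomial i := a (n - i)%N * x ^+ (n - i).
have px : (plus_part n a).[x]
    = \sum_(i < n.+1 | (2 * i < n.+1)%N) monomial (2 * i)%N.
  rewrite /plus_part horner_sum; apply: eq_bigr => i _.
  by rewrite hornerZ hornerXn.
have qx : (minus_part n a).[x]
    = \sum_(i < n.+1 | (2 * i + 1 < n.+1)%N) monomial (2 * i + 1)%N.
  rewrite /minus_part horner_sum; apply: eq_bigr => i _.
  by rewrite hornerZ hornerXn.
have fx : f.[x] = (plus_part n a).[x] - (minus_part n a).[x].
  rewrite px qx fE /alt_poly horner_sum -sumrN.
  under eq_bigr do rewrite hornerZ hornerXn -mulrA -/(monomial _).
  rewrite (sum_even_odd (fun i => (-1) ^+ i * monomial i)).
  congr (_ + _); apply: eq_bigr => i _.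
    by rewrite exprM sqrrN !expr1n mul1r.
  by rewrite exprD exprM sqrrN !expr1n expr1 mul1r mulN1r.
have mx : mirror f x = (plus_part n a).[x] + (minus_part n a).[x].
  rewrite px qx /mirror sf /= fE /alt_poly horner_sum -(sum_even_odd monomial).
  rewrite mulr_sumr; apply: eq_bigr => i _.
  rewrite hornerZ hornerXn [(- x) ^+ _]exprNn /monomial.
  have -> : (-1) ^+ n = (-1) ^+ i * (-1) ^+ (n - i) :> R.
    by rewrite -exprD subnKC // -ltnS.
  set s := (-1) ^+ i; set t := (-1) ^+ (n - i).
  rewrite [LHS](_ : _ = (s * s) * ((t * t) * (a (n - i)%N * x ^+ (n - i))));
    last by ring.
  by rewrite -!expr2 !sqrr_sign !mul1r.
by rewrite /kept_part /flipped_part fx mx; split; field.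
Qed.

(** * Monotone iterations *)

Lemma iter_limit_fixpoint (R : realType) (h : R -> R) (u : nat -> R) (L : R) :
  (forall t, u t.+1 = h (u t)) -> u t @[t --> \oo] --> L -> {for L, continuous h} ->
  h L = L.
Proof.
move=> uS uL hL.
have hu : h (u t) @[t --> \oo] --> h L by exact: (cvg_comp _ _ uL hL).
apply: (cvg_unique _ hu) => //.
rewrite (_ : (fun t => h (u t)) = fun t => u t.+1); last exact/funext.
by move: uL; rewrite -(cvg_shiftS _ (nbhs L)).
Qed.

(** Monotonicity of [h] propagates both [u 0 <= h (u 0)] and [u 0 <= b] along the
orbit.  Its supremum is at most [b]; if smaller, it is finite, hence a fixed point
of [h], which is excluded.  The orbit may reach [b] and stay there. *)
Lemma iter_increasing (R : realType) (h : R -> R) (u : nat -> R) (b : \bar R) :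
  (forall t, u t.+1 = h (u t)) ->
  (forall x y, 0 < x -> x <= y -> h x <= h y) ->
  0 < u 0 -> u 0 <= h (u 0) -> ((u 0)%:E <= b)%E ->
  (forall l, b = l%:E -> h l = l) ->
  (forall l, u 0 <= l -> (l%:E < b)%E -> {for l, continuous h} /\ h l <> l) ->
  (u t)%:E @[t --> \oo] --> b.
Proof.
move=> uS hh u0 u01 ub bfix nofix.
have ut t : 0 < u t /\ u t <= u t.+1.
  elim: t => [|t [t0 tS]]; first by rewrite uS.
  split; first exact: lt_le_trans t0 tS.
  by rewrite (uS t.+1) [leLHS]uS; apply: hh.
have homo : {homo u : s t / (s <= t)%N >-> s <= t}.
  by apply: homo_leq => //; [exact: le_trans|move=> t; exact: (ut t).2].
have utb t : ((u t)%:E <= b)%E.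
  case: b ub bfix {nofix} => [b| |] //; rewrite ?leey // lee_fin => ub bfix.
  elim: t => // t IH; rewrite lee_fin uS -(bfix b erefl).
  by apply: hh => //; exact: (ut t).1.
have /ereal_nondecreasing_cvgn :
    {homo (fun t => (u t)%:E) : s t / (s <= t)%N >-> (s <= t)%E}.
  by move=> s t /homo; rewrite lee_fin.
set S := ereal_sup _ => cS.
have : (S <= b)%E by apply: ge_ereal_sup => _ [t _ <-].
rewrite le_eqVlt => /predU1P[<- //|Sb].
have : ((u 0)%:E <= S)%E by apply: ereal_sup_ubound; exists 0%N.
case: S cS Sb => [l| |] cS Sb // u0l; last by rewrite ltNge leey in Sb.
have [hl []] := nofix l u0l Sb.
apply: (iter_limit_fixpoint uS) => //.
exact: (fine_cvg cS).
Qed.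

(** The lower bound [b = 0] is allowed without being a fixed point, since [h] is only
controlled for [x > 0]; positivity of the orbit replaces it. *)
Lemma iter_decreasing (R : realType) (h : R -> R) (u : nat -> R) (b : R) :
  (forall t, u t.+1 = h (u t)) ->
  (forall x, 0 < x -> 0 < h x) ->
  (forall x y, 0 < x -> x <= y -> h x <= h y) ->
  0 < u 0 -> h (u 0) <= u 0 -> 0 <= b <= u 0 ->
  (0 < b -> h b = b) ->
  (forall l, b < l -> l <= u 0 -> {for l, continuous h} /\ h l <> l) ->
  u t @[t --> \oo] --> b.
Proof.
move=> uS hpos hh u0 u01 /andP[b0 ub] bfix nofix.
have u_gt0 t : 0 < u t by elim: t => // t IH; rewrite uS hpos.
have utS t : u t.+1 <= u t.
  by elim: t => [|t IH]; rewrite (uS _) // [leRHS]uS hh.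
have homo : {homo u : s t / (s <= t)%N >-> t <= s}.
  by apply: homo_leq => // x y z xy yz; exact: le_trans yz xy.
have utb t : b <= u t.
  move: b0; rewrite le_eqVlt => /predU1P[<-|b0]; first exact: ltW.
  by elim: t => // t IH; rewrite uS -(bfix b0) hh.
have cu : cvgn u.
  by apply: nonincreasing_is_cvgn => //; exists b => _ [t _ <-].
have : b <= limn u by apply: limr_ge => //; near=> t; exact: utb.
rewrite le_eqVlt => /predU1P[-> //|bl].
have lu0 : limn u <= u 0 by apply: limr_le => //; near=> t; exact: homo.
have [hl []] := nofix _ bl lu0.
exact: (iter_limit_fixpoint uS).
Unshelve. all: by end_near. Qed.

(** * The two iterations *)

Lemma continuous_scaled_ratio (R : realType) (p q : {poly R}) (l : R) :
  q.[l] != 0 -> {for l, continuous (fun x : R => x * (p.[x] / q.[x]) : R)}.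
Proof.
move=> ql; apply: cvgM; first exact: cvg_id.
apply: cvgM; first exact: continuous_horner.
by apply: cvgV => //; exact: continuous_horner.
Qed.

Lemma scaled_ratio_mono (R : realType) (u v : R -> R) :
  (forall x, 0 < x -> 0 < v x) -> scaled_ratio_le u v ->
  forall x y, 0 < x -> x <= y -> x * (u x / v x) <= y * (u y / v y).
Proof.
move=> v0 uv x y x0 xy; rewrite !mulrA.
have y0 := lt_le_trans x0 xy.
rewrite ler_pdivrMr ?v0 // mulrAC ler_pdivlMr ?v0 //.
exact: uv.
Qed.

(** One statement for both cases of the theorem: its hypotheses on [p] and [q] are
symmetric except for the comparison at [x0]. *)
Lemma balanced_iterations_cvg (R : realType) (p q : {poly R}) (lo : R)
    (hi : \bar R) (x0 : R) (y z : nat -> R) :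
  (forall x, 0 < x -> 0 < p.[x]) -> (forall x, 0 < x -> 0 < q.[x]) ->
  scaled_ratio_le (horner p) (horner q) -> scaled_ratio_le (horner q) (horner p) ->
  0 <= lo -> lo < x0 -> (x0%:E < hi)%E ->
  (0 < lo -> p.[lo] = q.[lo]) -> (forall l, hi = l%:E -> p.[l] = q.[l]) ->
  (forall l, lo < l -> (l%:E < hi)%E -> p.[l] <> q.[l]) ->
  y 0 = x0 -> (forall t, y t.+1 = y t * (p.[y t] / q.[y t])) ->
  z 0 = x0 -> (forall t, z t.+1 = z t * (q.[z t] / p.[z t])) ->
  q.[x0] < p.[x0] ->
  (y t)%:E @[t --> \oo] --> hi /\ (z t)%:E @[t --> \oo] --> lo%:E.
Proof.
move=> p_gt0 q_gt0 pq qp lo_ge0 lox xhi lo_bal hi_bal gap y0 yS z0 zS qp0.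
have x_gt0 : 0 < x0 := le_lt_trans lo_ge0 lox.
have fixE (g h : {poly R}) l : 0 < h.[l] -> g.[l] = h.[l] -> l * (g.[l] / h.[l]) = l.
  by move=> h0 ->; rewrite divff ?mulr1 // gt_eqF.
have fixN (g h : {poly R}) l : 0 < l -> 0 < h.[l] -> l * (g.[l] / h.[l]) = l ->
    g.[l] = h.[l].
  move=> l0 h0 /(congr1 (fun w => l^-1 * w)).
  rewrite mulKf ?gt_eqF // mulVf ?gt_eqF // => /(congr1 ( *%R^~ h.[l])).
  by rewrite divfK ?mul1r ?gt_eqF.
split.
  apply: (iter_increasing (h := fun x => x * (p.[x] / q.[x]))) => //.
  - exact: scaled_ratio_mono.
  - by rewrite y0.
  - by rewrite y0 ler_peMr ?(ltW x_gt0) // ler_pdivlMr ?q_gt0 // mul1r ltW.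
  - by rewrite y0 ltW.
  - move=> l hil; apply: fixE; last exact: hi_bal.
    by apply: q_gt0; move: xhi; rewrite hil lte_fin; apply: lt_trans.
  - rewrite y0 => l xl lhi; have l0 := lt_le_trans x_gt0 xl; split.
      by apply: continuous_scaled_ratio; rewrite gt_eqF ?q_gt0.
    move/(fixN p q l l0 (q_gt0 _ l0)); apply: gap => //.
    exact: lt_le_trans xl.
apply: cvg_EFin; first exact: nearW.
apply: (iter_decreasing (h := fun x => x * (q.[x] / p.[x]))) => //.
- by move=> x xp; rewrite mulr_gt0 // divr_gt0 ?q_gt0 ?p_gt0.
- exact: scaled_ratio_mono.
- by rewrite z0.
- by rewrite z0 ger_pMr // ler_pdivrMr ?p_gt0 // mul1r ltW.
- by rewrite z0 lo_ge0 ltW.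
- by move=> lo0; apply: fixE; rewrite ?p_gt0 // lo_bal.
- rewrite z0 => l lol lx; have l0 := le_lt_trans lo_ge0 lol; split.
    by apply: continuous_scaled_ratio; rewrite gt_eqF ?p_gt0.
  move/(fixN q p l l0 (p_gt0 _ l0)) => /esym; apply: gap => //.
  by apply: le_lt_trans xhi; rewrite lee_fin.
Qed.

Lemma ext_rootE (R : realType) (r : seq R) (k : nat) :
  (k <= size r)%N -> ext_root r k = (nth 0 (0 :: r) k)%:E.
Proof.
by case: k => // k kr; rewrite /ext_root /= (nth_map 0).
Qed.

Lemma real_rootsP (R : realType) (f : {poly R}) (r : seq R) (x : R) :
  f != 0 -> real_roots_seq f r -> (x \in r) = root f x.
Proof.
move=> f0 [_ mupr]; rewrite -has_pred1 has_count mupr.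
by rewrite mup_geq // expr1 dvdp_XsubCl.
Qed.

Lemma no_root_between (R : realType) (r : seq R) (k : nat) (l : R) :
  sorted <=%R r -> (k <= size r)%N ->
  (ext_root r k < l%:E)%E -> (l%:E < ext_root r k.+1)%E -> l \notin r.
Proof.
move=> r_sorted kr kl lk; apply/negP => lr.
have jr : (index l r < size r)%N by rewrite index_mem.
have mono := le_sorted_leq_nth 0 r_sorted.
have [jk|kj] := ltnP (index l r) k.
  (* the entry [k] of [ext_root r] is the entry [k.-1] of [r] *)
  case: k kr kl {lk} jk => // k kr.
  rewrite ext_rootE // lte_fin /= ltNge => /negP kl jk; apply: kl.
  by rewrite -{1}(nth_index 0 lr); apply: mono.
have k_lt := leq_ltn_trans kj jr.
move: lk; rewrite ext_rootE // lte_fin /= ltNge => /negP; apply.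
by rewrite -{1}(nth_index 0 lr); apply: mono.
Qed.

Theorem theorem2 (R : realType) (n : nat) (a : nat -> R) (f p q : {poly R})
    (f_monic : f \is monic) (f_deg : size f = n.+1)
    (roots_Re_ge0 : forall z : R[i], complex_root f z -> 0 <= complex.Re z)
    (root_Re_gt0 : exists2 z : R[i], complex_root f z & 0 < complex.Re z)
    (a_lead : a n = 1) (f_def : f = alt_poly n a)
    (p_def : p = plus_part n a) (q_def : q = minus_part n a)
    (m : nat) (r : m.-tuple R) (r_roots : real_roots_seq f r)
    (k : nat) (k_le_m : (k <= m)%N)
    (x0 : R) (x0_gt : (ext_root r k < x0%:E)%E)
    (x0_lt : (x0%:E < ext_root r k.+1)%E)
    (x : int -> R) (x_init : x 0 = x0) (x_iter : two_sided_iteration p q x) :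
  (q.[x0] < p.[x0] ->
     (x t%:Z)%:E @[t --> \oo] --> ext_root r k.+1 /\
     (x (- t%:Z))%:E @[t --> \oo] --> ext_root r k) /\
  (p.[x0] < q.[x0] ->
     (x t%:Z)%:E @[t --> \oo] --> ext_root r k /\
     (x (- t%:Z))%:E @[t --> \oo] --> ext_root r k.+1).
Proof.
have roots x' : (x' \in tval r) = root f x'.
  by apply: real_rootsP; rewrite ?monic_neq0.
have root_ge0 l : l \in tval r -> 0 <= l.
  rewrite roots => fl; apply: (roots_Re_ge0 l%:C%C).
  by rewrite /complex_root fmorph_root.
have sp_f := schwarz_pick_of_roots f_monic roots_Re_ge0.
have pE : horner p = kept_part f.
  by apply/funext => w; rewrite p_def; exact: (parts_alt_poly w f_deg f_def).1.
have qE : horner q = flipped_part f.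
  by apply/funext => w; rewrite q_def; exact: (parts_alt_poly w f_deg f_def).2.
have p_gt0 w : 0 < w -> 0 < p.[w] by rewrite pE; exact: kept_gt0.
have q_gt0 w : 0 < w -> 0 < q.[w] by rewrite qE; exact: flipped_gt0.
have pq : scaled_ratio_le (horner p) (horner q).
  by rewrite pE qE; exact: kept_over_flipped.
have qp : scaled_ratio_le (horner q) (horner p).
  by rewrite pE qE; exact: flipped_over_kept.
have rootE l : root f l = (p.[l] == q.[l]).
  rewrite pE qE /root /kept_part /flipped_part.
  by rewrite -[RHS]subr_eq0; congr (_ == 0); field.
have k_size : (k <= size r)%N by rewrite size_tuple.
set lo := nth 0 (0 :: r) k.
have loE : ext_root r k = lo%:E by rewrite ext_rootE.
have lo_root : lo = 0 \/ lo \in tval r.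
  rewrite /lo; case: (k) k_size => [|j] jr /=; first by left.
  by right; rewrite mem_nth.
have lo_ge0 : 0 <= lo by case: lo_root => [-> //|/root_ge0].
have lo_bal : 0 < lo -> p.[lo] = q.[lo].
  case: lo_root => [->|]; first by rewrite ltxx.
  by rewrite roots rootE => /eqP.
have hi_bal l : ext_root r k.+1 = l%:E -> p.[l] = q.[l].
  rewrite /ext_root /=; have [kr|kr] := ltnP k (size r).
    by rewrite (nth_map 0) // => -[<-]; apply/eqP; rewrite -rootE -roots mem_nth.
  by rewrite nth_default // size_map.
have gap l : lo < l -> (l%:E < ext_root r k.+1)%E -> p.[l] <> q.[l].
  move=> lol lhi /eqP; rewrite -rootE -roots; apply/negP.
  by apply: no_root_between k_size _ lhi; rewrite ?loE ?lte_fin //; case: r_roots.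
rewrite loE in x0_gt *; rewrite lte_fin in x0_gt.
have bwd0 : x (- 0%:Z) = x0 by rewrite oppr0.
split=> cmp.
  exact: (balanced_iterations_cvg p_gt0 q_gt0 pq qp lo_ge0 x0_gt x0_lt lo_bal hi_bal
    gap x_init (fun t => (x_iter t).1) bwd0 (fun t => (x_iter t).2) cmp).
(* [p] and [q] exchange roles, and so do the two half-orbits *)
apply/and_comm.
exact: (balanced_iterations_cvg q_gt0 p_gt0 qp pq lo_ge0 x0_gt x0_lt
  (fun l0 => esym (lo_bal l0)) (fun l hl => esym (hi_bal l hl))
  (fun l l0 l1 e => gap l l0 l1 (esym e))
  bwd0 (fun t => (x_iter t).2) x_init (fun t => (x_iter t).1) cmp).
Qed.
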